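(* If $G$ is a diagonal graph, then $\mathrm{gir}(G)=3$, $4$, or $\infty$.
   Context: A graph means a finite simple undirected graph without loops, with nonempty vertex set $V(G)$ and edge set $E(G)$ (not necessarily connected). An $i$-cycle ($i\ge 3$) in $G$ is a tuple $(x_0,\dots,x_i)$ of vertices with $\{x_k,x_{k+1}\}\in E(G)$ for $0\le k\le i-1$, $x_0=x_i$, and $x_0,\dots,x_{i-1}$ all distinct. The local girth at a vertex $x$ is $\mathrm{gir}_x(G)=\inf\{i\ge3 \mid \text{there is an } i\text{-cycle in } G \text{ containing } x\}$, with $\inf\emptyset=\infty$, and the girth is $\mathrm{gir}(G)=\min_{x\in V(G)}\mathrm{gir}_x(G)$. Let $d(x,y)$ be the length of a shortest path between $x$ and $y$ ($\infty$ if there is none), and $L(x_0,\dots,x_k)=\sum_{i=1}^k d(x_{i-1},x_i)$. For integers $k,\ell\ge 0$, $\mathrm{MC}_{k,\ell}(G)$ is the free $\mathbb{Z}$-module generated by the tuples $(x_0,\dots,x_k)\in V(G)^{k+1}$ with $x_{i-1}\ne x_i$ for all $1\le i\le k$ and $L(x_0,\dots,x_k)=\ell$; $\mathrm{MC}_{-1,\ell}(G)=0$. The boundary map $\partial_{k,\ell}:\mathrm{MC}_{k,\ell}(G)\to\mathrm{MC}_{k-1,\ell}(G)$ is given for $k\ge1$ by $\partial_{k,\ell}(x_0,\dots,x_k)=\sum_{i} (-1)^i (x_0,\dots,\hat{x}_i,\dots,x_k)$, the sum over those $1\le i\le k-1$ with $d(x_{i-1},x_{i+1})=d(x_{i-1},x_i)+d(x_i,x_{i+1})$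 (the hat means deletion), and $\partial_{0,\ell}=0$. The magnitude homology is $\mathrm{MH}_{k,\ell}(G)=\ker\partial_{k,\ell}/\mathrm{Im}\,\partial_{k+1,\ell}$. A graph $G$ is diagonal if $\mathrm{MH}_{k,\ell}(G)=0$ for all $k\ne\ell$. *)

(* Defs.v *)
From HB Require Import structures.
From mathcomp Require Import all_boot all_order all_algebra.
From mathcomp Require Import boolp.
Set Implicit Arguments. Unset Strict Implicit. Unset Printing Implicit Defensive.
Import GRing.Theory.
Local Open Scope ring_scope.

Record sgraph := SGraph {
  vertex :> finType;
  adj : rel vertex;
  adj_sym : symmetric adj;
  adj_irrefl : irreflexive adj;
  vertex_nonempty : (0 < #|vertex|)%N }.

(* The extended natural numbers; [None] is infinity. *)
Definition enat := option nat.

Definition eadd (a b : enat) : enat :=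
  if a is Some m then if b is Some n then Some (m + n)%N else None else None.

Definition emin (a b : enat) : enat :=
  if a is Some m then if b is Some n then Some (minn m n) else a else b.

Definition einf (P : pred nat) : enat :=
  if pselect (exists n, P n) is left exP then Some (ex_minn exP) else None.

(* [c] lists x_0, ..., x_(i-1); the edge from x_(i-1) to x_i = x_0 is part of
   [ucycleb]. *)
Definition cycle_through (G : sgraph) (x : G) (i : nat) : bool :=
  [exists c : i.-tuple G, ucycleb (@adj G) c && (x \in c)].

Definition local_girth (G : sgraph) (x : G) : enat :=
  einf (fun i => (3 <= i)%N && cycle_through x i).

Definition girth (G : sgraph) : enat := \big[emin/None]_(x : G) local_girth x.

Definition dist (G : sgraph) (x y : G) : enat :=
  einf (fun n => [exists p : n.-tuple G, path (@adj G) x p && (last x p == y)]).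

Definition seqlen (G : sgraph) (s : seq G) : enat :=
  if s is x :: p then \big[eadd/Some 0%N]_(d <- pairmap (@dist G) x p) d
  else Some 0%N.

Definition is_gen (G : sgraph) (k l : nat) (t : k.+1.-tuple G) : bool :=
  sorted [rel x y | x != y] t && (seqlen t == Some l).

Definition gen (G : sgraph) (k l : nat) : finType :=
  {t : k.+1.-tuple G | is_gen l t}.

Definition MC (G : sgraph) (k l : nat) : zmodType := {ffun gen G k l -> int}.

(* The basis element of MC_{k,l} named by [s], or 0 when [s] is not a
   generator; see [del_is_gen] for the faces that occur in the boundary. *)
Definition basis (G : sgraph) (k l : nat) (s : seq G) : MC G k l :=
  [ffun u => ((val (val u) : seq G) == s)%:R].

Definition del (T : Type) (i : nat) (s : seq T) : seq T :=
  take i s ++ drop i.+1 s.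

Definition smooth (G : sgraph) (k : nat) (t : k.+1.-tuple G) (i : nat) : bool :=
  let x := nth (thead t) t in
  dist (x i.-1) (x i.+1) == eadd (dist (x i.-1) (x i)) (dist (x i) (x i.+1)).

Definition gen_boundary (G : sgraph) (k l : nat) (t : gen G k l) :
    MC G k.-1 l :=
  \sum_(1 <= i < k | smooth (val t) i)
    basis k.-1 l (del i (val t)) *~ ((-1) ^+ i).

(* For k = 0 the sum in [gen_boundary] is empty, so that [boundary 0 l] is the
   zero map; its formal target MC_{0,l} plays the role of MC_{-1,l} = 0. *)
Definition boundary (G : sgraph) (k l : nat) (c : MC G k l) : MC G k.-1 l :=
  \sum_(t : gen G k l) gen_boundary t *~ c t.

Lemma boundary_zmod_morphism (G : sgraph) (k l : nat) :
  zmod_morphism (@boundary G k l).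
Proof.
move=> c d; rewrite /boundary -sumrB; apply: eq_bigr => t _.
by rewrite !ffunE mulrzBr.
Qed.

HB.instance Definition _ (G : sgraph) (k l : nat) :=
  GRing.isZmodMorphism.Build (MC G k l) (MC G k.-1 l) (@boundary G k l)
    (@boundary_zmod_morphism G k l).

Definition is_cycle (G : sgraph) (k l : nat) : pred (MC G k l) :=
  fun c => boundary c == 0.

Lemma is_cycle_zmod_closed (G : sgraph) (k l : nat) :
  zmod_closed (@is_cycle G k l).
Proof.
split=> [|c d]; rewrite !unfold_in /is_cycle ?raddf0 //.
by move=> /eqP c0 /eqP d0; rewrite raddfB /= c0 d0 subrr.
Qed.

HB.instance Definition _ (G : sgraph) (k l : nat) :=
  GRing.isZmodClosed.Build (MC G k l) (@is_cycle G k l)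
    (@is_cycle_zmod_closed G k l).

Record cycles (G : sgraph) (k l : nat) := Cycle {
  cycle_chain :> MC G k l;
  _ : is_cycle cycle_chain }.

HB.instance Definition _ (G : sgraph) (k l : nat) :=
  [isSub for @cycle_chain G k l].
HB.instance Definition _ (G : sgraph) (k l : nat) :=
  [Choice of cycles G k l by <:].
HB.instance Definition _ (G : sgraph) (k l : nat) :=
  [SubChoice_isSubZmodule of cycles G k l by <:].

(* The image of the boundary map, as a subset of the cycles. *)
Definition is_boundary (G : sgraph) (k l : nat) : pred (cycles G k l) :=
  fun z => `[< exists c : MC G k.+1 l, boundary c = z :> MC G k l >].

Lemma is_boundary_zmod_closed (G : sgraph) (k l : nat) :
  zmod_closed (@is_boundary G k l).
Proof.
split=> [|y z]; rewrite !unfold_in /is_boundary; first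
  by apply/asboolP; exists 0; rewrite raddf0.
move=> /asboolP[c Hc] /asboolP[d Hd]; apply/asboolP; exists (c - d).
by rewrite raddfB /= Hc Hd.
Qed.

HB.instance Definition _ (G : sgraph) (k l : nat) :=
  GRing.isZmodClosed.Build (cycles G k l) (@is_boundary G k l)
    (@is_boundary_zmod_closed G k l).

Definition MH (G : sgraph) (k l : nat) : zmodType :=
  Quotient.quot
    (GRing.ZmodClosed.clone (cycles G k l) (@is_boundary G k l) _).

Definition diagonal (G : sgraph) : Prop :=
  forall k l : nat, k <> l -> forall h : MH G k l, h = 0.

Lemma dist0 (G : sgraph) (x y : G) : dist x y = Some 0%N -> x = y.
Proof.
rewrite /dist /einf; case: pselect => // exP; case: ex_minnP => n Hn _ [n0].
by move: Hn; rewrite n0 => /existsP[p]; rewrite tuple0 => /andP[_ /eqP].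
Qed.

Lemma distxx (G : sgraph) (x : G) : dist x x = Some 0%N.
Proof.
have H0 : [exists p : 0.-tuple G, path (@adj G) x p && (last x p == x)].
  by apply/existsP; exists [tuple]; rewrite /= eqxx.
rewrite /dist /einf; case: pselect => [exP|[]]; last by exists 0%N.
by case: ex_minnP => n _ /(_ _ H0); rewrite leqn0 => /eqP->.
Qed.

Lemma eaddA : associative eadd.
Proof. by move=> [a|] [b|] [c|] //=; rewrite addnA. Qed.

Lemma seqlen_del (G : sgraph) (a : seq G) (x y z : G) (b : seq G) :
  dist x z = eadd (dist x y) (dist y z) ->
  seqlen (a ++ x :: z :: b) = seqlen (a ++ x :: y :: z :: b).
Proof.
move=> H; case: a => [|w a] /=.
  by rewrite !big_cons H eaddA.
elim: a w => [|v a IH] w /=; first by rewrite !big_cons H !eaddA.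
by rewrite !big_cons IH.
Qed.

Lemma sorted_del (G : sgraph) (a : seq G) (x y z : G) (b : seq G) :
  x != z -> sorted [rel u v | u != v] (a ++ x :: y :: z :: b) ->
  sorted [rel u v | u != v] (a ++ x :: z :: b).
Proof.
move=> xz; case: a => [|w a] /=; first by rewrite xz /= => /and3P[].
by rewrite !cat_path /= xz => /and5P[-> -> _ _ ->].
Qed.

Lemma del_is_gen (G : sgraph) (k l : nat) (t : gen G k l) (i : nat) :
  (1 <= i < k)%N -> smooth (val t) i ->
  exists u : gen G k.-1 l, (val (val u) : seq G) = del i (val (val t)).
Proof.
case: t => t /= /andP[srt /eqP len] /andP[i0 ik].
case: k t srt len ik => // k t srt len ik; case: i i0 ik => // j _ jk sm.
have sz : size t = k.+2 by rewrite size_tuple.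
have splitE m : (m < k.+2)%N -> drop m t = nth (thead t) t m :: drop m.+1 t.
  by move=> ?; rewrite -drop_nth ?sz.
set x := nth (thead t) t j in sm *; set y := nth (thead t) t j.+1 in sm *.
set z := nth (thead t) t j.+2 in sm *.
have E : (t : seq G) = take j t ++ x :: y :: z :: drop j.+3 t.
  by rewrite -splitE 1?ltnS // -splitE 1?ltnW // -splitE ?cat_take_drop // ltnW // ltnW.
have D : del j.+1 t = take j t ++ x :: z :: drop j.+3 t.
  rewrite /del (take_nth (thead t)) ?sz; last by rewrite ltnW // ltnW.
  by rewrite cat_rcons splitE.
have Hd : dist x z = eadd (dist x y) (dist y z) by apply/eqP.
have xy : x != y.
  move: srt; rewrite E; case: (take j t) => [|w a] /=; first by case/andP.
  by rewrite cat_path /= => /and4P[].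
have xz : x != z.
  apply: contraNneq xy => xz; apply/eqP/dist0; move: Hd; rewrite -xz distxx.
  by case: (dist x y) => [[|m]|] //; case: (dist y x).
have szD : size (del j.+1 t) == k.+1.
  by move: sz; rewrite D {1}E !size_cat /= !addnS => -[->].
have gD : is_gen l (Tuple szD).
  rewrite /is_gen /= D (seqlen_del _ _ Hd) -E len eqxx andbT.
  by apply: (@sorted_del _ _ _ y) => //; rewrite -E.
by exists (exist _ (Tuple szD) gD).
Qed.

(* Main.v *)
(* Let g > 4 be the girth, x a vertex of a cycle C of length g, and w a vertex of
   C at maximal distance from x. Since no cycle is shorter than g, either g = 2m+1
   and w has a neighbour w' with d(x,w) = d(x,w') = m, or g = 2m and w has two
   neighbours a, b at distance m-1 from x. In the first case (x,w,w') is a cycle of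
   length m+1, detected by the cocycle summing the coefficients of all triples from
   x to w'. In the second, (w,a,x) - (w,b,x) is a cycle of length m, detected by the
   cocycle summing the coefficients of the triples (w,u,x) with u on a geodesic
   starting through a. So MH_{2,m+1} <> 0 with m > 1, or MH_{2,m} <> 0 with m > 2. *)
From HB Require Import structures.
From mathcomp Require Import all_boot all_order all_algebra.
From mathcomp Require Import boolp.
From mathcomp Require Import zify.
Require Import Defs.
Set Implicit Arguments. Unset Strict Implicit. Unset Printing Implicit Defensive.
Import GRing.Theory.

(** * Minimum and infimum of extended naturals *)

Lemma eminA : associative emin.
Proof. by move=> [a|] [b|] [c|] //=; rewrite minnA. Qed.

Lemma eminC : commutative emin.
Proof. by move=> [a|] [b|] //=; rewrite minnC. Qed.

Lemma emin0 : left_id None emin.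
Proof. by []. Qed.

HB.instance Definition _ := Monoid.isComLaw.Build enat None emin eminA eminC emin0.

Lemma einf_SomeP (P : pred nat) n :
  einf P = Some n <-> P n /\ forall m, P m -> n <= m.
Proof.
rewrite /einf; case: pselect => [exP|nP]; last first.
  by split=> // -[Pn _]; case: nP; exists n.
case: ex_minnP => m Pm minm; split=> [[<-] //|[Pn minn]].
by congr Some; apply/eqP; rewrite eqn_leq minm ?minn.
Qed.

Lemma einf_le (P : pred nat) n : P n -> exists2 m, einf P = Some m & m <= n.
Proof.
move=> Pn; rewrite /einf; case: pselect => [exP|[]]; last by exists n.
by case: ex_minnP => m _ minm; exists m; rewrite ?minm.
Qed.

(** * Girth, walks and distance *)

Definition no_cycle_below (G : sgraph) g := forall c : seq G,
  ucycle (@adj G) c -> 2 < size c -> g <= size c.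

Section Metric.
Variable G : sgraph.
Implicit Types (x y z u v w : G) (p c : seq G) (e : rel G).

Lemma girth_cycle g : girth G = Some g ->
  exists c, [/\ ucycle (@adj G) c, (2 < g) & size c = g].
Proof.
(* This property holds of [None] and passes through [emin], so it survives the iterated minimum
   defining [girth]. *)
pose attained (e : enat) := forall n, e = Some n -> exists x : G, local_girth x = Some n.
have: attained (girth G).
  rewrite /girth; apply: (big_ind attained) => //.
    move=> [a|] [b|] Ha Hb n /=.
    - by rewrite /minn; case: ifP => _ /esym ->; [apply: Ha | apply: Hb].
    - exact: Ha.
    - exact: Hb.
    - by [].
  by move=> x _ n; exists x.
move=> /[apply] -[x] /einf_SomeP[/andP[g3 /existsP[c /andP[uc _]]] _].
by exists c; rewrite size_tuple.
Qed.

Lemma girth_le g : girth G = Some g -> no_cycle_below G g.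
Proof.
move=> + [//|x c] uc sc; rewrite /girth (bigD1 x) //= {1}/local_girth.
have [|m -> mle] := @einf_le (fun i => (3 <= i) && cycle_through x i) (size (x :: c)).
  rewrite sc /=; apply/existsP; exists (in_tuple (x :: c)).
  by rewrite in_cons eqxx andbT; apply: uc.
case: (\big[_/_]_(_ | _) _) => [b|] /= [<-] //.
exact: leq_trans (geq_minl _ _) mle.
Qed.

Definition walk e x y n := exists p, [/\ path e x p, last x p = y & size p = n].

Lemma walk0 e x : walk e x x 0.
Proof. by exists [::]. Qed.

Lemma walk1 e x y : e x y -> walk e x y 1.
Proof. by move=> exy; exists [:: y]; rewrite /= exy. Qed.

Lemma walk_cat e x y z m n : walk e x y m -> walk e y z n -> walk e x z (m + n).
Proof.
move=> [p [ep lp <-]] [q [eq lq <-]]; exists (p ++ q).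
by rewrite cat_path last_cat size_cat lp ep.
Qed.

Lemma walk_sym e x y n : symmetric e -> walk e x y n -> walk e y x n.
Proof.
move=> esym [p [ep lp sp]]; exists (rev (belast x p)); split.
- by rewrite -lp rev_path (eq_path (e' := e)) // => u v; rewrite esym.
- by rewrite -lp; case: (p) => //= z q; rewrite rev_cons last_rcons.
- by rewrite size_rev size_belast.
Qed.

Lemma dist_SomeP x y n : dist x y = Some n <->
  walk (@adj G) x y n /\ forall m, walk (@adj G) x y m -> n <= m.
Proof.
have tP k : reflect (walk (@adj G) x y k)
    [exists p : k.-tuple G, path (@adj G) x p && (last x p == y)].
  apply: (iffP existsP) => [[p /andP[ep /eqP lp]]|[p [ep lp sp]]].
    by exists p; rewrite size_tuple.
  by move/eqP: sp => sp; exists (Tuple sp); rewrite /= ep lp eqxx.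
rewrite /dist einf_SomeP; split=> -[/tP H1 H2]; split=> // m /tP; exact: H2.
Qed.

Lemma dist_le x y n : walk (@adj G) x y n ->
  exists2 m, dist x y = Some m & m <= n.
Proof.
move=> [p [ep lp sp]]; apply: einf_le; apply/existsP.
by move/eqP: sp => sp; exists (Tuple sp); rewrite /= ep lp eqxx.
Qed.

Lemma dist_sym x y : dist x y = dist y x.
Proof.
have sym u v n : dist u v = Some n -> dist v u = Some n.
  move=> /dist_SomeP[wn minn]; apply/dist_SomeP; split=> [|m /walk_sym wm].
    exact: walk_sym (@adj_sym G) wn.
  exact/minn/wm/adj_sym.
case E: (dist x y) => [n|]; first by rewrite (sym _ _ _ E).
by case F: (dist y x) => [n|] //; rewrite (sym _ _ _ F) in E.
Qed.

Lemma dist_triangle x y z m n : dist x y = Some m -> dist y z = Some n ->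
  exists2 k, dist x z = Some k & k <= m + n.
Proof.
by move=> /dist_SomeP[wm _] /dist_SomeP[wn _]; apply/dist_le/(walk_cat wm wn).
Qed.

Lemma dist_gt0 x y n : x != y -> dist x y = Some n -> 0 < n.
Proof. by case: n => // /eqP xy /dist0. Qed.

Lemma adj_neq x y : adj x y -> x != y.
Proof. by apply: contraTneq => ->; rewrite adj_irrefl. Qed.

Lemma dist_adj x y : adj x y -> dist x y = Some 1.
Proof.
move=> axy; have [n E] := dist_le (walk1 axy).
by move: (dist_gt0 (adj_neq axy) E); rewrite E; case: n E => [|[]].
Qed.

Lemma dist_step x y n : dist x y = Some n.+1 ->
  exists2 z, adj x z & dist z y = Some n.
Proof.
move=> /dist_SomeP[[p [+ lp sp]] minn]; case: p lp sp => //= z p lp [sp] /andP[axz ep].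
have wz : walk (@adj G) z y n by exists p.
exists z => //; apply/dist_SomeP; split=> // m wm.
exact: (minn _ (walk_cat (walk1 axz) wm)).
Qed.

(** * Short cycles forced by coincidences of distances *)

Definition avoid_edge x y : rel G :=
  fun u v => adj u v && ([set u; v] != [set x; y]).

Lemma avoid_edge_sym x y : symmetric (avoid_edge x y).
Proof. by move=> u v; rewrite /avoid_edge adj_sym setUC. Qed.

Lemma avoid_edgeC x y : avoid_edge x y =2 avoid_edge y x.
Proof. by move=> u v; rewrite /avoid_edge (setUC [set x]). Qed.

Lemma avoid_edge_neq x y u v : adj u v -> x != u -> x != v -> avoid_edge x y u v.
Proof.
rewrite /avoid_edge => -> xu xv; apply/eqP => /setP/(_ x).
by rewrite !inE eqxx (negPf xu) (negPf xv).
Qed.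

(** Shorten the walk to a simple path and close it with the edge xy. The path has at least two edges
    because its only one-edge form is the forbidden edge. *)
Lemma cycle_avoid_edge x y n : adj x y -> walk (avoid_edge x y) y x n ->
  exists c, [/\ ucycle (@adj G) c, 2 < size c & size c <= n.+1].
Proof.
move=> axy [p [ep lp <-]]; case/shortenP: ep lp => q eq' uq qp lq.
have aq : path (@adj G) y q by apply: (sub_path _ eq') => u v /andP[].
exists (y :: q); split; last by rewrite /= ltnS; apply: uniq_leq_size qp; case/andP: uq.
- by rewrite /ucycle uq /= rcons_path aq lq axy.
- case: q eq' lq {uq qp aq} => [_ /= yx|z [|//]].
    by move: axy; rewrite yx adj_irrefl.
  by move=> /= /andP[/andP[_ nyx] _] zx; case/eqP: nyx; rewrite zx setUC.
Qed.

(** After w, a geodesic to v visits only vertices closer to v than n, hence closer than x. So it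
    misses x and every edge at x. *)
Lemma geodesic_avoid_edge v w x y n m : dist w v = Some n -> dist x v = Some m ->
  x != w -> n <= m -> walk (avoid_edge x y) w v n.
Proof.
elim: n w => [|n IH] w dw dx xw nm; first by rewrite (dist0 dw); apply: walk0.
have [z az dz] := dist_step dw.
have xz : x != z by apply: contraTneq nm => xz; rewrite -ltnNge; move: dx; rewrite xz dz => -[->].
rewrite -add1n; apply: walk_cat (IH z dz dx xz (ltnW nm)).
exact/walk1/avoid_edge_neq.
Qed.

(** The geodesic from y to v misses x and the one from x to v misses y; together they join the ends
    of xy without using that edge. *)
Lemma equidistant_cycle v x y n : adj x y -> dist x v = Some n -> dist y v = Some n ->
  exists c, [/\ ucycle (@adj G) c, 2 < size c & (size c <= n.*2.+1)].
Proof.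
move=> axy dx dy; rewrite -addnn; apply: (cycle_avoid_edge axy).
have xy := adj_neq axy.
apply: (walk_cat (geodesic_avoid_edge y dy dx xy (leqnn n))).
apply: (walk_sym (@avoid_edge_sym x y)); rewrite eq_sym in xy.
case: (geodesic_avoid_edge x dx dy xy (leqnn n)) => p [ep lp sp].
by exists p; split=> //; rewrite (eq_path (avoid_edgeC x y)).
Qed.

(** The geodesics from a and b to v both miss w, so following a to v to b and then the edge bw
    returns to w without using wa. *)
Lemma two_descents_cycle v w a b n : adj w a -> adj w b -> a != b ->
  dist w v = Some n.+1 -> dist a v = Some n -> dist b v = Some n ->
  exists c, [/\ ucycle (@adj G) c, 2 < size c & (size c <= n.+1.*2)].
Proof.
move=> wa wb ab dw da db.
have [c [uc c3 cn]] : exists c, [/\ ucycle (@adj G) c, 2 < size c &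
    (size c <= (n + (n + 1)).+1)].
  apply: (cycle_avoid_edge wa).
  apply: (walk_cat (geodesic_avoid_edge a da dw (adj_neq wa) (leqnSn n))).
  apply: (walk_sym (@avoid_edge_sym w a)); rewrite addnC.
  apply: (walk_cat _ (geodesic_avoid_edge a db dw (adj_neq wb) (leqnSn n))).
  apply: walk1; rewrite /avoid_edge wb; apply/eqP => /setP/(_ b).
  by rewrite !inE eqxx orbT eq_sym (negPf (adj_neq wb)) eq_sym (negPf ab).
by exists c; split=> //; lia.
Qed.

Lemma adj_dist_diff v x y m n : adj x y -> dist x v = Some m -> dist y v = Some n ->
  (m <= n.+1) /\ (n <= m.+1).
Proof.
move=> axy dx dy; have dxy := dist_adj axy.
have [k] := dist_triangle dxy dy; rewrite dx => -[<-] ?.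
have [k'] := dist_triangle (etrans (dist_sym y x) dxy) dx; rewrite dy => -[<-] ?.
by lia.
Qed.

(** Each step changes the distance to v by at most 1. If no step kept it fixed, [a + b + n] would be
    even. The bound on m goes through the rest of the walk and then from u to v. *)
Lemma odd_walk_equidistant v x u n a b : walk (@adj G) x u n ->
  dist x v = Some a -> dist u v = Some b -> odd (a + b + n) ->
  exists y z m, [/\ adj y z, dist y v = Some m, dist z v = Some m & m < b + n].
Proof.
move=> [p [ep lp <-]] {n}; elim: p x a ep lp => [|y p IH] x a /=.
  by move=> _ -> -> [->]; rewrite addn0 addnn odd_double.
move=> /andP[axy ep] lp dx du oab.
have wyu : walk (@adj G) y u (size p) by exists p.
have [|c dy cle] := @dist_le y v (size p + b).
  by apply: walk_cat wyu _; case/dist_SomeP: du.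
have [ac ca] := adj_dist_diff axy dx dy.
have [E|ne] := eqVneq a c; first by exists x, y, a; rewrite {2}E; split=> //; lia.
have [|y' [z' [m [? ? ? mlt]]]] := IH y c ep lp dy du.
  by move: oab ne; lia.
by exists y', z', m; split=> //; lia.
Qed.

(* The closed walk v -> x -> u -> v has odd length 2k+1, so it crosses an edge whose
   ends are equidistant from v. *)
Lemma excess1_cycle x u v k s t : dist x v = Some k -> dist x u = Some s ->
  dist u v = Some t -> (s + t = k.+1) ->
  exists c, [/\ ucycle (@adj G) c, 2 < size c & (size c <= k.*2.+1)].
Proof.
move=> dxv /dist_SomeP[wxu _] duv st.
have [|y [z [m [yz dy dz mlt]]]] := odd_walk_equidistant wxu dxv duv; first by lia.
have [c [uc c3 cm]] := equidistant_cycle yz dy dz.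
by exists c; split=> //; lia.
Qed.

(** * The vertex farthest from a base point on a shortest cycle *)

Lemma shortest_cycle_antipode g : girth G = Some g ->
  (exists x y z m, [/\ g = m.*2.+1, adj y z, dist y x = Some m & dist z x = Some m]) \/
  (exists v w a b m, [/\ g = m.+1.*2, adj w a, adj w b & a != b] /\
    [/\ dist w v = Some m.+1, dist a v = Some m & dist b v = Some m]).
Proof.
move=> gG; have [[|x p] [uc g3 sc]] := girth_cycle gG; first by rewrite -sc in g3.
have gle : no_cycle_below G g := girth_le gG.
set c := x :: p in uc sc; pose C := nth x c.
have [cc uq] := andP uc.
(* The default value of [nth] is x, so index g wraps around to the start of the cycle. *)
have Cg : C g = x by rewrite /C nth_default ?sc.
have adjC i : (i < g) -> adj (C i) (C i.+1).
  have pc : path (@adj G) x (rcons p x) := cc.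
  move=> ig; have := pathP x pc i; rewrite size_rcons [(size p).+1]sc => /(_ ig).
  by rewrite -rcons_cons !nth_rcons_default.
have wC i : (i <= g) -> walk (@adj G) (C i) x i.
  elim: i => [|i IH] ig; first exact: walk0.
  rewrite -add1n; apply: walk_cat (IH (ltnW ig)).
  by apply: walk1; rewrite adj_sym adjC.
have wC' i : (i <= g) -> walk (@adj G) (C (g - i)) x i.
  elim: i => [|i IH] ig; first by rewrite subn0 Cg; apply: walk0.
  rewrite -add1n; apply: walk_cat (IH (ltnW ig)).
  by apply: walk1; rewrite -(subnSK ig); apply: adjC; lia.
have dC i : (i <= g) -> exists n, [/\ dist (C i) x = Some n, (n <= i) & (n <= g - i)].
  move=> ig; have [n dn ni] := dist_le (wC i ig); exists n; split=> //.
  have [|n' + n'i] := dist_le (wC' (g - i) _); first lia.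
  by rewrite subKn // dn => -[->].
pose f i := odflt 0 (dist (C i) x).
have g0 : (0 < g) by lia.
(* Distances are those of G, not those along the cycle; maximality at [C i] bounds the distances of
   both its neighbours by j. *)
have [i _ maxi] := @arg_maxnP _ (Ordinal g0) xpredT (fun i : 'I_g => f i) isT.
have [j [di ji jg]] := dC i (ltnW (ltn_ord i)).
have fi : f i = j by rewrite /f di.
have max k : (k <= g) -> f k <= j.
  rewrite leq_eqVlt -fi => /predU1P[->|kg]; last exact: (maxi (Ordinal kg)).
  by rewrite /f Cg distxx.
have injC k k' : (k < g) -> (k' < g) -> C k = C k' -> k = k'.
  by move=> kg k'g /eqP; rewrite nth_uniq ?sc // => /eqP.
have j0 : (0 < j).
  have [n [d1 _ _]] := dC 1 g0.
  have := max 1 g0; rewrite /f d1 /=; apply: leq_trans.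
  apply: dist_gt0 d1; rewrite eq_sym; exact: adj_neq (adjC 0 g0).
have i0 : (0 < i) by lia.
have ig := ltn_ord i.
have aw : adj (C i.-1) (C i) by rewrite -{2}(prednK i0); apply: adjC; lia.
have wb : adj (C i) (C i.+1) by apply: adjC.
have [na [da na1 na2]] : exists n, [/\ dist (C i.-1) x = Some n, (n <= i.-1) & (n <= g - i.-1)].
  by apply: dC; lia.
have [nb [db nb1 nb2]] := dC i.+1 ig.
have /= maxa := max i.-1; rewrite /f da /= in maxa.
have /= maxb := max i.+1; rewrite /f db /= in maxb.
have [aj _] := adj_dist_diff aw da di.
have [ja _] := adj_dist_diff wb di db.
have [ja' _] := adj_dist_diff (etrans (adj_sym _ _) aw) di da.
have eqd y z n : adj y z -> dist y x = Some n -> dist z x = Some n ->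
    (g <= n.*2.+1).
  move=> yz dy dz; have [c' [uc' c'3]] := equidistant_cycle yz dy dz.
  exact/leq_trans/gle.
(* An equidistant edge gives g <= 2j+1, while the two arcs to x give 2j+1 <= g. *)
have [Ea|nea] := eqVneq na j.
  rewrite Ea in da na1; have := eqd _ _ _ aw da di => gj.
  by left; exists x, (C i.-1), (C i), j; split=> //; lia.
have [Eb|neb] := eqVneq nb j.
  rewrite Eb in db nb1 nb2; have := eqd _ _ _ wb di db => gj.
  by left; exists x, (C i), (C i.+1), j; split=> //; lia.
(* Both neighbours are now one step closer to x: two descents give g <= 2j, and the arcs give 2j <=
   g. *)
have Ej : j = na.+1 by lia.
have Ena : nb = na by lia.
have ab : C i.-1 != C i.+1.
  have [i1g|] := boolP (i.+1 < g).
    by apply/eqP => /injC; lia.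
  (* At the wrap-around the neighbours have indices g-2 and 0, which differ since g >= 3. *)
  rewrite -leqNgt => gi; have -> : i.+1 = g by lia.
  by rewrite Cg -[x]/(C 0); apply/eqP => /injC; lia.
rewrite Ej in di jg; rewrite Ena in db; rewrite adj_sym in aw.
have [c' [uc' c'3 /(leq_trans (gle _ uc' c'3)) gn]] :=
  two_descents_cycle aw wb ab di da db.
by right; exists x, (C i), (C i.-1), (C i.+1), na; split; split=> //; lia.
Qed.
End Metric.

(** * Detecting homology classes by cocycles *)

Section Homology.
Local Open Scope ring_scope.
Variable G : sgraph.
Implicit Types x y z u v a b : G.

Lemma diagonal_exact k l (c : MC G k l) : diagonal G -> k <> l -> boundary c = 0 ->
  exists d : MC G k.+1 l, boundary d = c.
Proof.
move=> dG kl /eqP c0; pose z : cycles G k l := Cycle c0.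
pose B := GRing.ZmodClosed.clone (cycles G k l) (@is_boundary G k l) _.
(* Equality in the quotient is membership of a difference in [B]; z and 0 both have class 0. *)
have: z - 0 \in B.
  by rewrite Quotient.idealrBE (dG k l kl (\pi z)%qT) (dG k l kl (\pi 0)%qT).
rewrite subr0 => /asboolP[d dz]; by exists d.
Qed.

(** Evaluation of an integer cochain on a chain. [W] takes bare sequences, so it applies to a face
    before that face is known to be a generator. *)
Definition pairing k l (W : seq G -> int) (c : MC G k l) : int :=
  \sum_(t : gen G k l) W (val (val t)) *~ c t.

Lemma pairing_zmod_morphism k l W : zmod_morphism (@pairing k l W).
Proof.
move=> c d; rewrite /pairing -sumrB; apply: eq_bigr => t _.
by rewrite !ffunE mulrzBr.
Qed.

HB.instance Definition _ k l W :=
  GRing.isZmodMorphism.Build (MC G k l) int (@pairing k l W)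
    (@pairing_zmod_morphism k l W).

Lemma pairing_basis k l W (t : gen G k l) : pairing W (basis k l (val (val t))) = W (val (val t)).
Proof.
rewrite /pairing (bigD1 t) //= ffunE eqxx big1 ?addr0 // => u ut.
by rewrite ffunE /= !val_eqE (negPf ut).
Qed.

Lemma boundary_basis k l (t : gen G k l) :
  boundary (basis k l (val (val t))) = gen_boundary t.
Proof.
rewrite /boundary (bigD1 t) //= ffunE eqxx big1 ?addr0 // => u ut.
by rewrite ffunE /= !val_eqE (negPf ut).
Qed.

Lemma pairing_boundary k l W (d : MC G k.+1 l) :
  (forall t : gen G k.+1 l,
     \sum_(1 <= i < k.+1 | smooth (val t) i) W (del i (val (val t))) *~ (-1) ^+ i = 0) ->
  pairing W (boundary d : MC G k l) = 0.
Proof.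
move=> Wt; rewrite /boundary raddf_sum big1 //= => t _.
suff E : pairing W (gen_boundary t : MC G k l) = 0 by rewrite raddfMz /= E mul0rz.
rewrite -[RHS](Wt t) /gen_boundary raddf_sum big_nat_cond [RHS]big_nat_cond /=.
apply: eq_bigr => i /andP[ik sm]; rewrite raddfMz; congr (_ *~ _).
(* A smooth face is a generator, so its [basis] chain is not the default 0 and pairs to its
   weight. *)
have [u Eu] := del_is_gen ik sm.
by rewrite -Eu; apply: pairing_basis.
Qed.


Definition endpoint_weight p q (w : G -> int) (s : seq G) : int :=
  if (nth p s 0 == p) && (nth p s 2 == q) then w (nth p s 1) else 0.

(** Faces keep the endpoints, so only tuples (p,y,z,q) matter. The condition on w makes both faces
    smooth; their weights w z and w y agree and have opposite signs. Hence the weight is a cocycle,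
    and it kills c, a boundary by diagonality. *)
Lemma diagonal_endpoint_pairing l p q w (c : MC G 2 l) : diagonal G -> 2%N <> l ->
  (forall y z r s t, p != y -> z != q ->
     dist p y = Some r -> dist y z = Some s -> dist z q = Some t -> l = (r + s + t)%N ->
     [/\ dist p z = Some (r + s)%N, dist y q = Some (s + t)%N & w y = w z]) ->
  boundary c = 0 -> pairing (endpoint_weight p q w) c = 0.
Proof.
move=> dG l2 Ww c0; have [d <-] := diagonal_exact dG l2 c0.
apply: pairing_boundary => -[[t /= sz] tgen].
case: t sz tgen => [|x [|y [|z [|u []]]]] //= sz /andP[/= /and4P[xy _ zu _]].
rewrite /= !big_cons big_nil unlock /= /smooth /del /endpoint_weight /=.
have [xp|_] := eqVneq x p; last by rewrite !mul0rz !if_same.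
have [uq|_] := eqVneq u q; last by rewrite !mul0rz !if_same.
subst x u; case dxy: (dist p y) => [r|] //; case dyz: (dist y z) => [s|] //.
case dzt: (dist z q) => [t|] //= /eqP[lE].
have [//|//||dxz dyt ->] := Ww y z r s t _ _ dxy dyz dzt; first lia.
rewrite dxz dyt !eqxx.
by rewrite addr0 expr1 sqrrN expr1n mulrN1z addNr.
Qed.

Lemma gen2_exists x y z m n : x != y -> y != z ->
  dist x y = Some m -> dist y z = Some n ->
  exists t : gen G 2 (m + n), val (val t) = [:: x; y; z] :> seq G.
Proof.
move=> xy yz dxy dyz.
have tgen : is_gen (m + n) [tuple x; y; z].
  by rewrite /is_gen /= xy yz !big_cons big_nil dxy dyz /= addn0 eqxx.
by exists (Sub [tuple x; y; z] tgen : gen G 2 (m + n)).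
Qed.

Lemma boundary_basis3 l (t : gen G 2 l) x y z : val (val t) = [:: x; y; z] :> seq G ->
  boundary (basis 2 l [:: x; y; z]) =
  if dist x z == eadd (dist x y) (dist y z) then - basis 1 l [:: x; z] else 0.
Proof.
move=> tE; rewrite -tE boundary_basis /gen_boundary tE; case: t tE => -[s /= sz] sgen sE.
subst s; rewrite unlock /= /smooth /del /= expr1 addr0 mulrN1z.
by [].
Qed.

(** * Off-diagonal classes for odd and even girth *)

Lemma odd_girth_not_diagonal m x y z : no_cycle_below G m.*2.+1 ->
  (1 < m)%N -> adj y z -> dist y x = Some m -> dist z x = Some m -> ~ diagonal G.
Proof.
move=> short m1 yz dyx dzx dG.
(* If d(b,d) were less than s+t, the triangle inequality at a would force d(b,d) = s+t-1 = m-r < m,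
   and excess 1 would give a cycle shorter than 2m+1. *)
have geo (a b c d : G) r s t : a != b -> dist a b = Some r -> dist b c = Some s ->
    dist c d = Some t -> dist a d = Some m -> m.+1 = (r + s + t)%N ->
    dist b d = Some (s + t)%N.
  move=> ab dab dbc dcd dad mE; have [k dbd kst] := dist_triangle dbc dcd.
  have [m' + m'k] := dist_triangle dab dbd; rewrite dad => -[?]; subst m'.
  have r0 := dist_gt0 ab dab.
  have [E|ne] := eqVneq k (s + t)%N; first by rewrite dbd E.
  have [|c' [uc c3 ck]] := excess1_cycle dbd dbc dcd; first lia.
  by have := short c' uc c3; lia.
have xy : x != y by apply: contraTneq m1 => E; move: dyx; rewrite E distxx => -[<-].
have dxy : dist x y = Some m by rewrite dist_sym.
have dxz : dist x z = Some m by rewrite dist_sym.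
have [t tE] := gen2_exists xy (adj_neq yz) dxy (dist_adj yz).
have := pairing_basis (endpoint_weight x z (fun=> 1)) t.
rewrite tE {2}/endpoint_weight /= !eqxx.
rewrite (diagonal_endpoint_pairing dG) //; first lia.
- move=> b c r s q xb cz dxb dbc dcz lE; split=> //; last first.
    by apply: geo dxb dbc dcz dxz _; lia.
  (* The other face is the same claim for the reversed tuple. *)
  rewrite addnC dist_sym; rewrite eq_sym in cz.
  by apply: geo cz _ _ _ _ _; rewrite 1?dist_sym; try eassumption; lia.
- rewrite (boundary_basis3 tE) dxz dxy (dist_adj yz) /= ifF //.
  by apply/eqP => -[]; lia.
Qed.

Lemma even_girth_not_diagonal n x y a b : no_cycle_below G n.+1.*2 ->
  (1 < n)%N -> adj x a -> adj x b -> a != b ->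
  dist x y = Some n.+1 -> dist a y = Some n -> dist b y = Some n -> ~ diagonal G.
Proof.
move=> short n1 xa xb ab dxy day dby dG.
have ay : a != y by apply: contraTneq n1 => E; move: day; rewrite E distxx => -[<-].
have nby : b != y by apply: contraTneq n1 => E; move: dby; rewrite E distxx => -[<-].
have [ta taE] := gen2_exists (adj_neq xa) ay (dist_adj xa) day.
have [tb tbE] := gen2_exists (adj_neq xb) nby (dist_adj xb) dby.
(* For u at finite distance from x, this tests whether a lies on a geodesic from x to u. *)
pose w u : int := (dist x u == eadd (Some 1%N) (dist a u))%:R.
pose W := endpoint_weight x y w.
have := congr2 (fun i j => i - j) (pairing_basis W ta) (pairing_basis W tb).
rewrite -raddfB taE tbE {2 3}/W /endpoint_weight /= !eqxx /=.
have -> : w a = 1 by rewrite /w distxx dist_adj.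
have -> : w b = 0.
  rewrite /w dist_adj //; case dab: (dist a b) => [[|k]|] //.
  by rewrite (dist0 dab) eqxx in ab.
rewrite (diagonal_endpoint_pairing dG) //; first lia.
- move=> u v r s t xu vy dxu duv dvy lE.
  have [k dxv kE] := dist_triangle dxu duv.
  have [k' + k'E] := dist_triangle dxv dvy; rewrite dxy => -[?]; subst k'.
  have [i duy iE] := dist_triangle duv dvy.
  have [i' + i'E] := dist_triangle dxu duy; rewrite dxy => -[?]; subst i'.
  (* The length n+1 equals d(x,y), so (x,u,v,y) lies on a geodesic and all triangle inequalities are
     equalities. *)
  have Ek : k = (r + s)%N by lia.
  have Ei : i = (s + t)%N by lia.
  subst k i; split=> //; rewrite /w dxu dxv; congr (_%:R); congr nat_of_bool.
  have r0 := dist_gt0 xu dxu; have t0 := dist_gt0 vy dvy.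
  apply/eqP/eqP.
    case dau: (dist a u) => [r'|] //= [rE].
    have [j dav jE] := dist_triangle dau duv.
    have [j' + j'E] := dist_triangle (dist_adj xa) dav; rewrite dxv => -[?].
    by rewrite dav /=; congr Some; lia.
  case dav: (dist a v) => [j|] //= [jE].
  case: r r0 dxu lE dxv kE iE i'E k'E jE => // r' _ dxu lE dxv _ _ _ _ jE.
  (* If a geodesic from x to u starts at z other than a, then a and z are two descents from x
     towards v. This gives a cycle of length at most 2d(x,v) < 2(n+1), since v differs from y. *)
  have [z xz dzu] := dist_step dxu.
  have [->|az] := eqVneq a z; first by rewrite dzu.
  have [j' dzv j'E] := dist_triangle dzu duv.
  have [j'' + j''E] := dist_triangle (dist_adj xz) dzv; rewrite dxv => -[?].
  have Ej : j = (r' + s)%N by lia.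
  have Ej' : j' = (r' + s)%N by lia.
  subst j j'; have [c [uc c3 cn]] := @two_descents_cycle G v x a z (r' + s)%N xa xz az dxv dav dzv.
  by have := short c uc c3; lia.
- rewrite raddfB /= (boundary_basis3 taE) (boundary_basis3 tbE).
  by rewrite dxy day dby !dist_adj //= subrr.
Qed.
End Homology.

Theorem corollary1p6 (G : sgraph) (hG : diagonal G) :
  girth G = Some 3 \/ girth G = Some 4 \/ girth G = None.
Proof.
case gG: (girth G) => [g|]; last by right; right.
have [c0 [_ g3 _]] := girth_cycle gG.
have [g5|g4] := leqP 5 g; last first.
  have [->|->] : g = 3 \/ g = 4 by lia.
    by left.
  by right; left.
have short := girth_le gG.
(* In both parities g >= 5 gives m >= 2, so the length m+1 of the class differs from its degree
   2. *)
case: (shortest_cycle_antipode gG).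
  move=> [x [y [z [m [gE yz dy dz]]]]]; subst g.
  by case: (odd_girth_not_diagonal short _ yz dy dz hG); lia.
move=> [v [w [a [b [m [[gE wa wb ab] [dw da db]]]]]]]; subst g.
by case: (even_girth_not_diagonal short _ wa wb ab dw da db hG); lia.
Qed.
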